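(* Let $\varphi:\mathbb{R}^q\to\mathbb{R}_+$ be a finite convex function with $\varphi(0)=0$ and $\varphi(u)>0$ for $u\neq 0$. Let $A\in\mathbb{R}^{m\times n}$ and $M\in\mathbb{R}^{m\times q}$, where $m<n$ and $m\le q$, be full-rank matrices, and let $k$ be a positive integer. Suppose that for any given $\varepsilon\ge 0$ and any given $y\in\mathbb{R}^m$, every vector $x\in\mathbb{R}^n$ satisfying $\varphi(M^T(Ax-y))\le\varepsilon$ can be approximated by an optimal solution $x^*$ of the problem $$\min_z\{\|z\|_1:\ \varphi(M^T(Az-y))\le\varepsilon\}$$ with error $$\|x-x^*\|_2\le C'\sigma_k(x)_1+C''\gamma(\varepsilon),$$ where $C'$ and $C''$ are constants depending on the problem data $(M,A,y,\varepsilon)$ (but not on $x$), and $\gamma(\cdot)$ is a continuous function on $[0,\infty)$ satisfying $\gamma(0)=0$, $\gamma(\varepsilon)>0$ for $\varepsilon>0$, and, for each $y$, $C''\gamma(\varepsilon)\to 0$ as $\varepsilon\to 0$. Then $A^T$ satisfies the weak range space property (weak RSP) of order $k$.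
   Context: For $x\in\mathbb{R}^n$, $\sigma_k(x)_1:=\inf_u\{\|x-u\|_1:\ \|u\|_0\le k\}$, where $\|u\|_0$ is the number of nonzero entries of $u$. Weak RSP: for $A\in\mathbb{R}^{m\times n}$ with $m<n$, $A^T$ satisfies the weak range space property of order $k$ if for any disjoint subsets $S_1,S_2\subseteq\{1,\dots,n\}$ with $|S_1|+|S_2|\le k$ there exists a vector $\zeta\in\mathcal{R}(A^T)=\{A^Tu: u\in\mathbb{R}^m\}$ such that $\zeta_i=1$ for $i\in S_1$, $\zeta_i=-1$ for $i\in S_2$, and $|\zeta_i|\le 1$ for $i\notin S_1\cup S_2$. *)

(* Defs.v *)
From HB Require Import structures.
From mathcomp Require Import all_boot all_order all_algebra.
From mathcomp Require Import all_classical all_reals all_analysis.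

Set Implicit Arguments.
Unset Strict Implicit.
Unset Printing Implicit Defensive.

Import Order.TTheory GRing.Theory Num.Theory.
Import numFieldNormedType.Exports.

Local Open Scope classical_set_scope.
Local Open Scope ring_scope.

(* The library's norm on matrices is the max norm, hence these definitions. *)
Definition norm1 (R : realType) (n : nat) (x : 'cV[R]_n) : R :=
  \sum_(i < n) `|x i 0|.

Definition norm2 (R : realType) (n : nat) (x : 'cV[R]_n) : R :=
  Num.sqrt (\sum_(i < n) (x i 0) ^+ 2).

Definition norm0 (R : realType) (n : nat) (x : 'cV[R]_n) : nat :=
  #|[set i : 'I_n | x i 0 != 0]%SET|.

Definition sigma1 (R : realType) (n k : nat) (x : 'cV[R]_n) : R :=
  inf [set norm1 (x - u) | u in [set u : 'cV[R]_n | (norm0 u <= k)%N]].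

Definition full_rank (R : realType) (m n : nat) (B : 'M[R]_(m, n)) : Prop :=
  \rank B = minn m n.

Definition range_space (R : realType) (m n : nat) (B : 'M[R]_(m, n)) :
    set 'cV[R]_m :=
  [set B *m u | u in [set: 'cV[R]_n]].

(* The matrix argument plays the role of A^T in the usual phrasing
   "A^T satisfies the weak RSP of order k". *)
Definition weak_RSP (R : realType) (n m : nat) (B : 'M[R]_(n, m)) (k : nat) :
    Prop :=
  forall S1 S2 : {set 'I_n}, [disjoint S1 & S2]%B -> (#|S1| + #|S2| <= k)%N ->
  exists zeta : 'cV[R]_n,
    [/\ range_space B zeta,
        forall i, i \in S1 -> zeta i 0 = 1,
        forall i, i \in S2 -> zeta i 0 = -1 &
        forall i, i \notin (S1 :|: S2)%SET -> `|zeta i 0| <= 1].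

Definition feasible (R : realType) (m n q : nat) (phi : 'cV[R]_q -> R)
    (A : 'M[R]_(m, n)) (M : 'M[R]_(m, q)) (y : 'cV[R]_m) (eps : R) :
    set 'cV[R]_n :=
  [set z | phi (M^T *m (A *m z - y)) <= eps].

Definition l1_solutions (R : realType) (n : nat) (D : set 'cV[R]_n) :
    set 'cV[R]_n :=
  [set x | D x /\ forall z, D z -> norm1 x <= norm1 z].

(* Main.v *)
(* Taking eps = 0 and y = A x for a k-sparse x makes the error bound vanish (so
   x is feasible and equal to an optimal solution): every k-sparse x minimizes
   the l1 norm over x + ker A.  For the sign vector s = 1_S1 - 1_S2 the
   first-order optimality condition says that the functional v |-> - <s, v> is
   dominated on ker A by the seminorm p(v), the sum of |v_i| over the i outside
   S1 and S2.  By Hahn-Banach some b with <b, v> <= p(v) everywhere extends it;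
   then b vanishes on S1 and S2, |b_i| <= 1 elsewhere, and zeta = b + s is
   orthogonal to ker A, that is, zeta lies in the range of A^T. *)
Require Import Defs.
From HB Require Import structures.
From mathcomp Require Import all_boot all_order all_algebra.
From mathcomp Require Import all_classical all_reals all_analysis.
From mathcomp Require Import lra.

Set Implicit Arguments.
Unset Strict Implicit.
Unset Printing Implicit Defensive.

Import Order.TTheory GRing.Theory Num.Theory.
Import numFieldNormedType.Exports.

Local Open Scope classical_set_scope.
Local Open Scope ring_scope.

Section HahnBanach.
Variables (R : realType) (n : nat) (p : 'rV[R]_n -> R).
Hypothesis subadd : forall u v : 'rV[R]_n, p (u + v) <= p u + p v.
Hypothesis homog : forall (c : R) (u : 'rV[R]_n), 0 < c -> p (c *: u) = c * p u.

(** By subadditivity at [t *m B - e] and [t' *m B + e], where [e] cancels, each lower bound that [p]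
    imposes on the value at [e] lies below each upper bound; [c] is the supremum of the lower
    bounds. Homogeneity reduces [s] to 1 or -1. The rows of [B] may be dependent: the domination
    keeps the values [a] consistent. *)
Lemma dominated_extension1 (r : nat) (B : 'M[R]_(r, n)) (a : 'cV[R]_r)
    (e : 'rV[R]_n) :
  (forall t : 'rV_r, (t *m a) 0 0 <= p (t *m B)) ->
  exists c : R, forall (t : 'rV_r) (s : R),
    (t *m a) 0 0 + s * c <= p (t *m B + s *: e).
Proof.
move=> dom.
have gap (t t' : 'rV_r) :
    (t *m a) 0 0 - p (t *m B - e) <= p (t' *m B + e) - (t' *m a) 0 0.
  have := dom (t + t'); rewrite !mulmxDl mxE => le1.
  have := subadd (t *m B - e) (t' *m B + e); rewrite addrACA addNr addr0 => le2.
  lra.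
pose E := [set (t *m a) 0 0 - p (t *m B - e) | t in [set: 'rV[R]_r]].
have E0 : E !=set0 by exists (((0 : 'rV_r) *m a) 0 0 - p (0 *m B - e)), 0.
have supP : has_sup E.
  split=> //; pose t0 := 0 : 'rV[R]_r.
  exists (p (t0 *m B + e) - (t0 *m a) 0 0) => _ [t _ <-].
  exact: gap.
have geE t : (t *m a) 0 0 - p (t *m B - e) <= sup E.
  by apply: ub_le_sup; [exact: supP.2 | exists t].
have leE t : sup E <= p (t *m B + e) - (t *m a) 0 0.
  by apply: ge_sup => // _ [t' _ <-]; exact: gap.
have scaled (c : R) (t : 'rV_r) v : 0 < c ->
    (t *m a) 0 0 = c * ((c^-1 *: t) *m a) 0 0 /\
    p (t *m B + c *: v) = c * p ((c^-1 *: t) *m B + v).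
  move=> c0; rewrite -homog // scalerDr -!scalemxAl scalerA mulfV ?gt_eqF //.
  by rewrite scale1r [X in c * X]mxE mulrA mulfV ?gt_eqF // mul1r.
exists (sup E) => t s; have [s0|s0|->] := ltgtP s 0.
- have [-> ] := scaled (- s) t (- e) ltac:(by rewrite oppr_gt0).
  rewrite scalerN scaleNr opprK => ->.
  have := geE ((- s)^-1 *: t); set x := (_ *m _) 0 0; set y := p _.
  by move=> h; nra.
- have [-> ->] := scaled s t e s0.
  have := leE (s^-1 *: t); set x := (_ *m _) 0 0; set y := p _.
  by move=> h; nra.
- by rewrite mul0r scale0r !addr0.
Qed.

(** Induction on the rows of [E]: the first one is appended to [B], with its value [c] appended to
    [a], and the remaining rows are treated over this larger subspace. *)
Lemma dominated_extension (s r : nat) (B : 'M[R]_(r, n)) (a : 'cV[R]_r)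
    (E : 'M[R]_(s, n)) :
  (forall t : 'rV_r, (t *m a) 0 0 <= p (t *m B)) ->
  exists b : 'cV[R]_s, forall (t : 'rV_r) (u : 'rV_s),
    (t *m a) 0 0 + (u *m b) 0 0 <= p (t *m B + u *m E).
Proof.
elim: s r B a E => [|s IH] r B a E dom.
  by exists 0 => t u; rewrite mulmx0 [X in _ + X]mxE addr0 thinmx0 mul0mx addr0.
rewrite -[s.+1]add1n in E *; rewrite -[E]vsubmxK.
have [c domc] := dominated_extension1 (usubmx E) dom.
have dom' (t : 'rV_(r + 1)) :
    (t *m col_mx a c%:M) 0 0 <= p (t *m col_mx B (usubmx E)).
  rewrite -[t]hsubmxK !mul_row_col mxE (mx11_scalar (rsubmx t)).
  by rewrite -scalar_mxM mul_scalar_mx [X in _ + X <= _]mxE mulr1n; exact: domc.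
have [b domb] := IH _ _ _ (dsubmx E) dom'.
exists (col_mx c%:M b) => t u; rewrite -[u]hsubmxK !mul_row_col.
have := domb (row_mx t (lsubmx u)) (rsubmx u).
by rewrite !mul_row_col !mxE !addrA.
Qed.

(* Hahn-Banach on R^n: the subspace is the row space of B, on which the
   functional is given by the values a on the rows of B. *)
Lemma hahn_banach (r : nat) (B : 'M[R]_(r, n)) (a : 'cV[R]_r) :
  (forall t : 'rV_r, (t *m a) 0 0 <= p (t *m B)) ->
  exists2 b : 'cV[R]_n, B *m b = a & forall u, (u *m b) 0 0 <= p u.
Proof.
(* The rows of the identity span the whole space, so adjoining them needs no complement of the row
   space of [B]. *)
move=> dom; have [b domb] := dominated_extension 1%:M dom.
have p0 : p 0 = 0.
  by have := homog 0 (ltr0n R 2); rewrite scaler0 => h; lra.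
exists b => [|u]; last first.
  by have := domb 0 u; rewrite !mul0mx mxE !add0r mulmx1.
(* The bound at [t *m B - t *m B = 0] gives one inequality; the other follows from it at the
   opposite vector. *)
have le0 (t : 'rV_r) : (t *m a) 0 0 <= (t *m (B *m b)) 0 0.
  have := domb t (- (t *m B)).
  by rewrite mulmx1 subrr p0 mulNmx mulmxA [X in _ + X]mxE subr_le0.
apply/colP => i; apply/eqP; rewrite eq_le.
have entry (v : 'cV[R]_r) : v i 0 = ((delta_mx 0 i : 'rV_r) *m v) 0 0.
  by rewrite -rowE mxE.
have := le0 (- (delta_mx 0 i : 'rV_r)).
rewrite !mulNmx [X in X <= _]mxE [X in _ <= X]mxE.
by rewrite lerN2 !entry le0 andbT.
Qed.

End HahnBanach.

Lemma norm1_ge0 (R : realType) (n : nat) (x : 'cV[R]_n) : 0 <= norm1 x.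
Proof. by apply: sumr_ge0 => i _. Qed.

Lemma norm2_le0 (R : realType) (n : nat) (x : 'cV[R]_n) :
  norm2 x <= 0 -> x = 0.
Proof.
move=> x0; apply/colP => i; rewrite mxE; apply/eqP; rewrite -sqrf_eq0.
have : \sum_(i < n) x i 0 ^+ 2 = 0.
  apply/eqP; rewrite eq_le sumr_ge0 ?andbT; last by move=> j _; exact: sqr_ge0.
  by rewrite -sqrtr_eq0 eq_le x0 sqrtr_ge0.
by move=> /psumr_eq0P -> // j _; exact: sqr_ge0.
Qed.

Lemma sigma1_sparse (R : realType) (n k : nat) (x : 'cV[R]_n) :
  (norm0 x <= k)%N -> sigma1 k x = 0.
Proof.
move=> xk; set D := [set norm1 (x - u) | u in [set u | (norm0 u <= k)%N]].
have D0 : D 0.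
  by exists x => //; rewrite subrr /norm1 big1 // => i _; rewrite mxE normr0.
have lbD : lbound D 0 by move=> _ [u _ <-]; exact: norm1_ge0.
apply/eqP; rewrite eq_le; apply/andP; split.
  by apply: ge_inf => //; exists 0.
by apply: lb_le_inf => //; exists 0.
Qed.

(** For [d] this small, [s + d] does not cross zero when [s] is 1 or -1, so the first-order
    expansion of the absolute value has no remainder. *)
Lemma ler_norm_sign (R : realType) (s d : R) :
  [\/ s = 0, s = 1 | s = -1] -> `|d| <= 1 ->
  `|s + d| <= `|s| + s * d + (if s == 0 then `|d| else 0).
Proof.
move=> sgn; rewrite ler_norml => /andP[d1 d2]; case: sgn => ->.
- by rewrite eqxx normr0 mul0r !add0r.
- by rewrite oner_eq0 normr1 ger0_norm; lra.
- by rewrite oppr_eq0 oner_eq0 normrN normr1 ler0_norm; lra.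
Qed.

(* The right-hand side minus the left-hand side is the directional derivative
   at s, along v, of the l1 norm. *)
Lemma l1_min_directional (R : realType) (n : nat) (s v : 'cV[R]_n) :
  (forall i, [\/ s i 0 = 0, s i 0 = 1 | s i 0 = -1]) ->
  (forall c : R, norm1 s <= norm1 (s + c *: v)) ->
  - (\sum_i s i 0 * v i 0) <= \sum_(i | s i 0 == 0) `|v i 0|.
Proof.
move=> sgn smin; pose c := (1 + norm1 v)^-1.
have c0 : 0 < c by rewrite invr_gt0 ltr_wpDr ?norm1_ge0.
have cv i : `|c * v i 0| <= 1.
  rewrite normrM gtr0_norm // mulrC ler_pdivrMr; last by rewrite -invr_gt0.
  by rewrite mul1r /norm1 (bigD1 i) //= addrCA lerDl addr_ge0 // sumr_ge0.
have : norm1 (s + c *: v) <= norm1 s +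
    c * (\sum_i s i 0 * v i 0 + \sum_(i | s i 0 == 0) `|v i 0|).
  rewrite [\sum_(i | s i 0 == 0) _]big_mkcond /= -big_split /=.
  rewrite mulr_sumr -big_split /=.
  apply: ler_sum => i _; rewrite !mxE.
  apply: le_trans (ler_norm_sign (sgn i) (cv i)) _.
  rewrite mulrDr addrA mulrCA; case: ifP => _; last by rewrite mulr0.
  by rewrite normrM (gtr0_norm c0).
move/(le_trans (smin c)); rewrite -[X in X <= _]addr0 lerD2l pmulr_rge0 //.
by move=> h; lra.
Qed.

Theorem theorem2p7 (R : realType) (m n q k : nat)
    (phi : 'cV[R]_q -> R)
    (phi_ge0 : forall u, 0 <= phi u)
    (phi_convex : convex_function [set: 'cV[R]_q] phi)
    (phi0 : phi 0 = 0)
    (phi_gt0 : forall u, u != 0 -> 0 < phi u)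
    (A : 'M[R]_(m, n)) (M : 'M[R]_(m, q))
    (ltmn : (m < n)%N) (lemq : (m <= q)%N)
    (A_full : full_rank A) (M_full : full_rank M)
    (k_gt0 : (0 < k)%N)
    (C' C'' : 'cV[R]_m -> R -> R) (gamma : R -> R)
    (gamma_cont : {within `[0, +oo[, continuous gamma})
    (gamma0 : gamma 0 = 0)
    (gamma_gt0 : forall eps, 0 < eps -> 0 < gamma eps)
    (C''gamma_cvg0 : forall y : 'cV[R]_m,
      C'' y eps * gamma eps @[eps --> 0^'+] --> 0)
    (approx : forall (eps : R) (y : 'cV[R]_m), 0 <= eps ->
      forall x : 'cV[R]_n, feasible phi A M y eps x ->
      exists2 xstar : 'cV[R]_n,
        l1_solutions (feasible phi A M y eps) xstar &
        norm2 (x - xstar) <= C' y eps * sigma1 k x + C'' y eps * gamma eps) :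
  weak_RSP A^T k.
Proof.
have sparse_min x z : (norm0 x <= k)%N -> A *m z = A *m x -> norm1 x <= norm1 z.
  move=> xk Az; have feas u : A *m u = A *m x -> feasible phi A M (A *m x) 0 u.
    by rewrite /feasible /= => ->; rewrite subrr mulmx0 phi0.
  have [xs [_ xs_min]] := approx 0 (A *m x) (lexx 0) x (feas x erefl).
  rewrite sigma1_sparse // gamma0 !mulr0 addr0 => /norm2_le0/subr0_eq ->.
  by apply: xs_min; exact: feas.
move=> S1 S2 dis12 card12.
pose s : 'cV[R]_n := \col_i ((i \in S1)%:R - (i \in S2)%:R).
have sS1 i : i \in S1 -> s i 0 = 1.
  by move=> i1; rewrite mxE i1 (disjointFr dis12 i1) subr0.
have sS2 i : i \in S2 -> s i 0 = -1.
  by move=> i2; rewrite mxE i2 (disjointFl dis12 i2) sub0r.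
have sS0 i : i \notin (S1 :|: S2)%SET -> s i 0 = 0.
  by rewrite inE negb_or mxE => /andP[/negbTE-> /negbTE->]; rewrite subr0.
have sgn i : [\/ s i 0 = 0, s i 0 = 1 | s i 0 = -1].
  have [i1|i1] := boolP (i \in S1); first by constructor 2; exact: sS1.
  have [i2|i2] := boolP (i \in S2); first by constructor 3; exact: sS2.
  by constructor 1; apply: sS0; rewrite inE negb_or i1.
have sk : (norm0 s <= k)%N.
  apply: leq_trans card12; apply: leq_trans (leq_card_setU S1 S2).
  apply/subset_leq_card/fintype.subsetP => i; rewrite inE.
  by apply: contraR => /sS0 ->.
clearbody s; pose p (v : 'rV[R]_n) := \sum_(i | s i 0 == 0) `|v 0 i|.
have p_sub u v : p (u + v) <= p u + p v.
  by rewrite -big_split; apply: ler_sum => i _; rewrite mxE ler_normD.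
have p_hom c u : 0 < c -> p (c *: u) = c * p u.
  move=> c0; rewrite mulr_sumr; apply: eq_bigr => i _.
  by rewrite mxE normrM gtr0_norm.
(* The rows of [(cokermx A)^T] span ker A, and [- ((cokermx A)^T *m s)] lists the values on them of
   the functional to extend. *)
have dom (t : 'rV_n) :
    (t *m - ((cokermx A)^T *m s)) 0 0 <= p (t *m (cokermx A)^T).
  rewrite mulmxN mulmxA; set v := t *m _.
  have Av : A *m v^T = 0 by rewrite trmx_mul trmxK mulmxA mulmx_coker mul0mx.
  have smin c : norm1 s <= norm1 (s + c *: v^T).
    by apply: sparse_min => //; rewrite mulmxDr -scalemxAr Av scaler0 addr0.
  rewrite [X in X <= _]mxE; have := l1_min_directional sgn smin.
  have -> : \sum_i s i 0 * v^T i 0 = (v *m s) 0 0.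
    by rewrite mxE; apply: eq_bigr => i _; rewrite [v^T _ _]mxE mulrC.
  by move/le_trans; apply; apply: ler_sum => i _; rewrite mxE.
have [b Bb ble] := hahn_banach p_sub p_hom dom.
(* Testing the domination at plus and minus the i-th unit vector bounds the entry by the value of
   [p] there: 0 on the support of [s], 1 off it. *)
have entry i : `|b i 0| <= (s i 0 == 0)%:R.
  have pd : p (delta_mx 0 i) = (s i 0 == 0)%:R.
    rewrite /p big_mkcond (bigD1 i) //= big1 ?addr0 => [|j /negbTE ji].
      by rewrite mxE !eqxx normr1; case: ifP.
    by rewrite mxE ji andbF normr0 if_same.
  have pN : p (- delta_mx 0 i) = p (delta_mx 0 i).
    by apply: eq_bigr => j _; rewrite mxE normrN.
  rewrite ler_norml lerNl -pd; apply/andP; split.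
    by have := ble (- delta_mx 0 i); rewrite pN mulNmx -rowE !mxE.
  by have := ble (delta_mx 0 i); rewrite -rowE mxE.
exists (b + s); split.
(* Membership in the row space of [A] amounts to being annihilated by [cokermx A], which is what
   [Bb] says after transposition. *)
- have : ((b + s)^T <= A)%MS.
    rewrite submxE -[X in _ *m X]trmxK -trmx_mul mulmxDr Bb addNr.
    by rewrite trmx0.
  move=> /submxP[D eqD]; exists D^T => //.
  by rewrite -trmx_mul -eqD trmxK.
- move=> i i1; have := entry i; rewrite mxE sS1 // oner_eq0.
  by rewrite normr_le0 => /eqP->; rewrite add0r.
- move=> i i2; have := entry i; rewrite mxE sS2 // oppr_eq0 oner_eq0.
  by rewrite normr_le0 => /eqP->; rewrite add0r.
- by move=> i i0; have := entry i; rewrite mxE sS0 // eqxx addr0.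
Qed.
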